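(* Let $M$ be a rationally supported submonoid of $(\mathbb{Z}^2,+)$. If the set $\mathcal{A}(M)$ of atoms of $M$ is infinite, then $M$ is atomic.
   Context: Let $M$ be a submonoid of $(\mathbb{Z}^2,+)$, with identity $0=(0,0)$. $\mathcal{U}(M)$ denotes the group of invertible elements of $M$. An element $a\in M\setminus\mathcal{U}(M)$ is an atom if whenever $a=r+s$ with $r,s\in M$, either $r\in\mathcal{U}(M)$ or $s\in\mathcal{U}(M)$; $\mathcal{A}(M)$ is the set of atoms of $M$. $M$ is atomic if every element of $M\setminus\mathcal{U}(M)$ is a finite sum of atoms of $M$. A supporting line of $M$ is a line through the origin of $\mathbb{R}^2$ such that $M$ is contained in one of the two closed half-planes determined by that line. $M$ is rationally supported if it has a supporting line with rational slope. *)

(* Defs.v *)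
From HB Require Import structures.
From mathcomp Require Import all_boot all_order all_algebra.
From mathcomp Require Import boolp classical_sets cardinality reals.

Set Implicit Arguments.
Unset Strict Implicit.
Unset Printing Implicit Defensive.

Import Order.TTheory GRing.Theory Num.Theory.

Local Open Scope classical_set_scope.
Local Open Scope ring_scope.

Definition submonoid (M : set (int * int)) : Prop :=
  M 0 /\ forall x y, M x -> M y -> M (x + y).

Definition invertibles (M : set (int * int)) : set (int * int) :=
  [set x | M x /\ exists2 y, M y & x + y = 0].

Definition atoms (M : set (int * int)) : set (int * int) :=
  [set a | (M `\` invertibles M) a /\
    forall r s, M r -> M s -> a = r + s -> invertibles M r \/ invertibles M s].

Definition atomic (M : set (int * int)) : Prop :=
  forall x, (M `\` invertibles M) x ->
    exists2 s : seq (int * int),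
      {in s, forall a, atoms M a} & x = \sum_(a <- s) a.

Section Plane.
Variable R : realType.
Implicit Types (n p : R * R) (L : set (R * R)).

Definition plane_of (x : int * int) : R * R := (x.1%:~R, x.2%:~R).

Definition dot n p : R := n.1 * p.1 + n.2 * p.2.

(* A line through the origin is presented by a nonzero normal vector n; the
   two closed half-planes it determines are then 0 <= dot n p and
   dot n p <= 0. *)
Definition supporting_line (M : set (int * int)) L : Prop :=
  exists n, [/\ n != 0, L = [set p | dot n p = 0] &
    plane_of @` M `<=` [set p | 0 <= dot n p] \/
    plane_of @` M `<=` [set p | dot n p <= 0]].

(* The vertical axis (slope 1/0) counts as a line of rational slope, so that
   the notion does not depend on the order of the two coordinates. *)
Definition rational_slope L : Prop :=
  (exists q : rat, L = [set p | p.2 = ratr q * p.1]) \/ L = [set p | p.1 = 0].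

Definition rationally_supported (M : set (int * int)) : Prop :=
  exists2 L, supporting_line M L & rational_slope L.

End Plane.

(* Main.v *)
Require Import Defs.
From HB Require Import structures.
From mathcomp Require Import all_boot all_order all_algebra.
From mathcomp Require Import boolp classical_sets cardinality reals.
From mathcomp Require Import zify ring.

(** Clearing denominators in the rational slope gives an integral linear form
    [f], nonnegative on [M], and turning its gradient by a right angle gives a
    second form [g] such that [f] and [g] together are injective.  Call [f x]
    the level of [x].  All units lie on level 0.

    If every element of level 0 is a unit, each proper factorization strictly
    lowers the level, and induction on the level factors every nonunit into
    atoms ([atomic_of_level0_units]).

    Otherwise some nonunit [e] lies on level 0, and after a change of sign
    [g e > 0].  Then [g >= 0] on level 0, since an element with [g < 0] would
    combine with [e] to make [e] a unit; hence 0 is the only unit.  There are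
    two possibilities for the columns [x + Z e] with [x] in [M] and [f x > 0].

    - Some whole column lies in [M].  Then [m x + n e] is in [M] for all
      [m >= 1] and all integers [n], and so is [n e] for all [n >= 0].  Hence
      of two distinct elements congruent modulo the finite-index subgroup
      generated by [x] and [e], the one with the larger [(f, g)] in
      lexicographic order is the sum of the other and an element of [M]; they
      cannot both be atoms, so [M] has finitely many atoms
      ([finite_atoms_of_full_column]).

    - Otherwise each column leaves [M] when followed downwards.  A level meets
      finitely many residue classes modulo [g e], and in each of them the
      elements of [M] are closed under adding [e], so [g] is bounded below on
      each level.  A proper factorization then lowers either [f], or [g] on a
      fixed level, and descent gives atomicity ([atomic_of_columns_bounded]).

    Infinitely many atoms exclude the first possibility. *)

Set Implicit Arguments.
Unset Strict Implicit.
Unset Printing Implicit Defensive.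

Import Order.TTheory GRing.Theory Num.Theory.

Local Open Scope classical_set_scope.
Local Open Scope ring_scope.

(** * Submonoids, units and factorizations *)

Definition nonunits (M : set (int * int)) := M `\` invertibles M.

Lemma submonoid_mulrn M x n : submonoid M -> M x -> M (x *+ n).
Proof.
move=> [M0 MD] Mx; elim: n => [|n IHn]; first by rewrite mulr0n.
by rewrite mulrS; apply: MD.
Qed.

Lemma invertible0 M : submonoid M -> invertibles M 0.
Proof. by move=> [M0 _]; split=> //; exists 0; rewrite ?addr0. Qed.

Lemma reducible_split M x : nonunits M x -> ~ atoms M x ->
  exists r s, [/\ nonunits M r, nonunits M s & x = r + s].
Proof.
move=> NUx Nat; apply: contrapT => Nrs; apply: Nat; split=> // r s Mr Ms xE.
case: (pselect (invertibles M r)) => [|Nr]; first by left.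
case: (pselect (invertibles M s)) => [|Ns]; first by right.
by case: Nrs; exists r, s.
Qed.

(** Well-founded descent on the lexicographic order of [(f x, h x)].  By
    commutativity the hypothesis on the first summand covers both. *)
Lemma atomic_of_lex_decrease M (f h : int * int -> nat) :
  (forall r s, nonunits M r -> nonunits M s ->
     (f r < f (r + s)%R)%N \/ (f r = f (r + s) /\ (h r < h (r + s)%R)%N)) ->
  atomic M.
Proof.
move=> dec x; have [k fxk] := ubnP (f x).
elim: k x fxk => // k IHk x; have [l hxl] := ubnP (h x).
elim: l x hxl => // l IHl x hxl fxk NUx.
have [atx|Natx] := pselect (atoms M x).
  exists [:: x]; last by rewrite big_seq1.
  by move=> a; rewrite inE => /eqP ->.
have [r [s [NUr NUs xE]]] := reducible_split NUx Natx.
have factor y z : nonunits M y -> nonunits M z -> x = y + z ->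
    exists2 t : seq (int * int), {in t, forall a, atoms M a} &
      y = \sum_(a <- t) a.
  move=> NUy NUz xyz; have := dec y z NUy NUz; rewrite -xyz.
  case=> [flt|[fE hlt]].
    by apply: IHk => //; apply: leq_trans flt _; rewrite -ltnS.
  apply: IHl => //; last by rewrite fE.
  by apply: leq_trans hlt _; rewrite -ltnS.
have [t atr rE] := factor r s NUr NUs xE.
have [u ats sE] := factor s r NUs NUr (etrans xE (addrC r s)).
exists (t ++ u); last by rewrite big_cat /= -rE -sE.
by move=> a; rewrite mem_cat => /orP[/atr|/ats].
Qed.

(** * Integral linear forms *)

Lemma int_mulrn (z : int) n : z *+ n = z * n%:Z.
Proof. by rewrite -mulr_natr natz. Qed.

Definition linform (a b : int) (x : int * int) : int := a * x.1 + b * x.2.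

Lemma linform_is_additive a b : {morph linform a b : x y / x - y}.
Proof. by move=> x y; rewrite /linform /=; ring. Qed.

HB.instance Definition _ a b :=
  GRing.isZmodMorphism.Build _ _ (linform a b) (linform_is_additive a b).

(** The two gradients are orthogonal, so the determinant of the pair is
    [a ^+ 2 + b ^+ 2]; this avoids completing a primitive vector to a basis of
    the lattice, at the cost of a pair that need not be surjective. *)
Lemma linform_inj_pair a b x y : (a != 0) || (b != 0) ->
  linform a b x = linform a b y -> linform (- b) a x = linform (- b) a y ->
  x = y.
Proof.
rewrite /linform => ab0 E1 E2; have det : a ^+ 2 + b ^+ 2 != 0.
  by rewrite paddr_eq0 ?sqr_ge0 // !sqrf_eq0 negb_and.
case: x y E1 E2 => [x1 x2] [y1 y2] /= E1 E2.
have E (u v : int) : (a ^+ 2 + b ^+ 2) * (u - v) = 0 -> u = v.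
  by move/eqP; rewrite mulf_eq0 (negPf det) subr_eq0 => /eqP.
congr (_, _); apply: E.
  transitivity (a * (a * x1 + b * x2 - (a * y1 + b * y2))
                - b * (- b * x1 + a * x2 - (- b * y1 + a * y2))); first by ring.
  by rewrite E1 E2; ring.
transitivity (b * (a * x1 + b * x2 - (a * y1 + b * y2))
              + a * (- b * x1 + a * x2 - (- b * y1 + a * y2))); first by ring.
by rewrite E1 E2; ring.
Qed.

(** * Monoids on one side of an integral line *)

Section Supported.
Variables (M : set (int * int)) (f g : {additive (int * int)%type -> int}).
Hypothesis hM : submonoid M.
Hypothesis f_ge0 : forall x, M x -> 0 <= f x.
Hypothesis fg_inj : forall x y, f x = f y -> g x = g y -> x = y.

Lemma invertible_level0 x : invertibles M x -> f x = 0.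
Proof.
move=> [Mx [y My xy0]].
have := f_ge0 Mx; have := f_ge0 My; have := congr1 f xy0.
rewrite raddfD raddf0; lia.
Qed.

Lemma atomic_of_level0_units :
  (forall x, M x -> f x = 0 -> invertibles M x) -> atomic M.
Proof.
move=> units.
apply: (@atomic_of_lex_decrease M (fun x => `|f x|%N) (fun=> 0%N)).
move=> r s [Mr _] [Ms NUs]; left.
have fs0 : f s != 0 by apply/eqP => fs0; apply: NUs; apply: units.
have := f_ge0 Mr; have := f_ge0 Ms; rewrite raddfD; lia.
Qed.

Variable e : int * int.
Hypothesis eNU : nonunits M e.
Hypothesis fe : f e = 0.
Hypothesis ge : 0 < g e.

Let Me : M e. Proof. by case: eNU. Qed.

(** If [g y < 0] then [(- g y) e + (g e) y = 0], which makes [e] a unit. *)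
Lemma level0_ge0 y : M y -> f y = 0 -> 0 <= g y.
Proof.
move=> My fy; rewrite leNgt; apply/negP => gy; case: eNU => _; apply.
split=> //; exists (e *+ (`|g y|.-1) + y *+ `|g e|).
  by apply: hM.2; apply: submonoid_mulrn.
apply: fg_inj; rewrite !raddfD !raddfMn ?fe ?fy ?raddf0; first by lia.
have -> : g y *+ `|g e| = g y * g e by rewrite int_mulrn gez0_abs ?ltW.
have -> : g e *+ `|g y|.-1 = g e * (- g y - 1).
  by rewrite int_mulrn; congr (_ * _); lia.
by ring.
Qed.

Lemma invertible_eq0 y : invertibles M y -> y = 0.
Proof.
move=> Uy; have fy := invertible_level0 Uy; case: Uy => My [z Mz yz].
have fz : f z = 0 by have := congr1 f yz; rewrite raddfD raddf0; lia.
have := level0_ge0 My fy; have := level0_ge0 Mz fz.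
have := congr1 g yz; rewrite raddfD raddf0 => gyz gz gy.
apply: fg_inj; rewrite raddf0 //; lia.
Qed.

(** It is enough to bound [g] on each of the finitely many residue classes
    modulo [g e]: in a class, two points of level [k] differ by a multiple of
    [e], so below a point [x0 - e *+ n] outside [M] there is none in [M]. *)
Lemma level_bounded k :
  (forall x, M x -> f x = k -> exists n, ~ M (x - e *+ n)) ->
  exists B, forall x, M x -> f x = k -> B <= g x.
Proof.
move=> leaves.
have /choice[B BP] : forall i : nat, exists B : int,
    forall x, M x -> f x = k -> (g x %% g e)%Z = i -> B <= g x.
  move=> i.
  have [[x0 [Mx0 fx0 gx0]]|none] :=
      pselect (exists x0, [/\ M x0, f x0 = k & (g x0 %% g e)%Z = i]).
    have [n Nn] := leaves x0 Mx0 fx0; exists (g x0 - g e * n%:Z) => x Mx fx gx.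
    rewrite leNgt; apply/negP => lt; apply: Nn.
    have gxE := divz_eq (g x) (g e); have gx0E := divz_eq (g x0) (g e).
    pose m := ((g x0 %/ g e)%Z - (g x %/ g e)%Z - n%:Z).
    have gm : g x0 - g e * n%:Z = g x + m * g e.
      by rewrite {1}gxE {1}gx0E gx gx0 /m; ring.
    have m_gt0 : 0 < m by nia.
    suff -> : x0 - e *+ n = x + e *+ `|m|.
      by apply: hM.2 => //; apply: submonoid_mulrn.
    apply: fg_inj; rewrite raddfB raddfD.
      by rewrite !(raddfMn f) fe fx fx0 !mul0rn.
    by rewrite !(raddfMn g) !int_mulrn gez0_abs ?ltW // gm mulrC.
  by exists 0 => x Mx fx gx; case: none; exists x.
(* A common lower bound for all the [B i] with [i < g e]. *)
exists (- \sum_(i < `|g e|) `|B i|) => x Mx fx.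
have lt : (`|(g x %% g e)%Z| < `|g e|)%N.
  have := modz_ge0 (g x) (lt0r_neq0 ge); have := ltz_pmod (g x) ge; lia.
have := BP `|(g x %% g e)%Z|%N x Mx fx.
have -> : (g x %% g e)%Z = `|(g x %% g e)%Z|%N.
  by have := modz_ge0 (g x) (lt0r_neq0 ge); lia.
move=> /(_ erefl); apply: le_trans.
rewrite (bigD1 (Ordinal lt)) //=.
rewrite opprD -[leRHS]addr0; apply: lerD; last by rewrite oppr_le0 sumr_ge0.
by rewrite lerNl (le_trans (ler_norm _)) ?normrN.
Qed.

(** In [r + s] with [s] a nonunit, either [f s > 0] and the level of [r] is
    smaller, or [f s = 0] and then [g s > 0], so [r] is lower on its level; the
    bounds [B] turn height on a level into a natural number. *)
Lemma atomic_of_columns_bounded :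
  (forall x, M x -> 0 < f x -> exists n, ~ M (x - e *+ n)) -> atomic M.
Proof.
move=> leaves.
have /choice[B BP] : forall k, exists B, forall x, M x -> f x = k -> B <= g x.
  move=> k; apply: level_bounded => x Mx fx.
  have [fx0|] := ltP 0 (f x); first exact: leaves.
  move=> fx0; have {}fx0 : f x = 0 by have := f_ge0 Mx; lia.
  (* On level 0 the column leaves [M] as soon as [g] becomes negative. *)
  exists `|g x|.+1 => /level0_ge0.
  rewrite (raddfB f) (raddfB g) (raddfMn f) (raddfMn g).
  rewrite fe fx0 mul0rn subr0 int_mulrn => /(_ erefl).
  have gx := level0_ge0 Mx fx0.
  have -> : `|g x|.+1%:Z = g x + 1 by lia.
  have : g x + 1 <= g e * (g x + 1) by rewrite ler_peMl //; lia.
  by rewrite subr_ge0 => /le_trans /[apply]; rewrite -subr_ge0 opprD addNKr.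
apply: (@atomic_of_lex_decrease M
  (fun x => `|f x|%N) (fun x => `|(g x - B (f x))%R|%N)).
move=> r s [Mr _] [Ms NUs].
have := f_ge0 Mr; have := f_ge0 Ms; rewrite !raddfD => fs fr.
have [fs0|fs_gt0] := eqVneq (f s) 0; last by left; lia.
right; rewrite fs0 addr0; split=> //.
have gs0 : g s != 0.
  apply/eqP => gs0; apply: NUs.
  suff -> : s = 0 by exact: invertible0.
  by apply: fg_inj; rewrite raddf0.
have := level0_ge0 Ms fs0; have := BP _ _ Mr erefl; lia.
Qed.

Section FullColumn.
Variable x : int * int.
Hypothesis fx : 0 < f x.
Hypothesis full : forall n, M (x - e *+ n).

Lemma full_column (n : int) : M (x + e *~ n).
Proof.
case: (intP n) => [|m|m].
- by rewrite mulr0z addr0 -[x]subr0 -(mulr0n e); apply: full.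
- have -> : x + e *~ m.+1 = x - e *+ 0 + e *+ m.+1 by rewrite mulr0n subr0.
  by apply: hM.2; [exact: full|exact: submonoid_mulrn].
- by rewrite mulrNz; apply: full.
Qed.

(** The difference of two congruent atoms cannot be a nonzero element of [M].
    The first modulus is [f x * g e], not [f x]: then the multiple of [x] needed
    to match levels changes [g] by a multiple of [g e], so that the congruences
    on [f] and on [g] can be imposed separately. *)
Lemma congruent_atom_not_higher a b : atoms M a -> atoms M b ->
  (f a = f b %[mod f x * g e])%Z -> (g a = g b %[mod g e])%Z ->
  ~ f b < f a /\ ~ (f b = f a /\ g b < g a).
Proof.
move=> [[Ma _] irr] [[Mb NUb] _] fab gab.
have residue y : M y -> a = b + y -> y = 0.
  by move=> My aE; have [/NUb|/invertible_eq0] := irr b y Mb My aE.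
move/eqP: gab; rewrite eqz_mod_dvd => /dvdzP[n gn].
move/eqP: fab; rewrite eqz_mod_dvd => /dvdzP[m fm].
split.
  move=> lt; have m_gt0 : 0 < m.
    have prod_gt0 : 0 < f x * g e by exact: mulr_gt0.
    by rewrite -(pmulr_lgt0 _ prod_gt0) -fm subr_gt0.
  (* [a - b] is [N] copies of [x] plus a multiple of [e] of arbitrary sign; one
     copy of [x] absorbs that multiple, because its whole column is in [M]. *)
  pose N := `|(m * g e)%R|%N.
  have NE : N%:Z = m * g e by rewrite gez0_abs // mulr_ge0 ?ltW.
  have N_gt0 : (0 < N)%N by rewrite -ltz_nat NE mulr_gt0.
  pose y := x *+ N.-1 + (x + e *~ (n - m * g x)).
  have My : M y.
    apply: hM.2; last exact: full_column.
    by apply: submonoid_mulrn => //; rewrite -[x]subr0 -(mulr0n e); apply: full.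
  have fy : f y = f a - f b.
    rewrite /y !(raddfD f) (raddfMn f) (raddfMz f) fe mul0rz addr0.
    by rewrite -mulrSr prednK // fm !int_mulrn NE; ring.
  have gy : g y = g a - g b.
    rewrite /y !(raddfD g) (raddfMn g) (raddfMz g) addrA -mulrSr prednK // gn.
    by rewrite !int_mulrn NE mulrzz; ring.
  have aE : a = b + y by apply: fg_inj; rewrite raddfD ?fy ?gy addrC subrK.
  have := residue y My aE => y0; move: fy; rewrite y0 raddf0; lia.
move=> [fE lt].
have n_gt0 : 0 < n by rewrite -(pmulr_lgt0 _ ge) -gn subr_gt0.
have gy : g (e *+ `|n|) = g a - g b.
  by rewrite raddfMn int_mulrn gez0_abs ?ltW // gn mulrC.
have aE : a = b + e *+ `|n|.
  apply: fg_inj; rewrite raddfD ?gy 1?addrC ?subrK //.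
  by rewrite raddfMn fe mul0rn add0r fE.
have y0 := residue _ (submonoid_mulrn _ hM Me) aE.
by move: lt; rewrite -subr_gt0 -gy y0 raddf0 ltxx.
Qed.

(** Pigeonhole: an atom is determined by its two residues. *)
Lemma finite_atoms_of_full_column : finite_set (atoms M).
Proof.
have kd_gt0 : 0 < f x * g e by exact: mulr_gt0.
pose key y : 'I_(`|f x * g e|.+1) * 'I_(`|g e|.+1) :=
  (inord `|(f y %% (f x * g e))%Z|, inord `|(g y %% g e)%Z|).
have inord_mod d (u v : int) : 0 < d ->
    (inord `|(u %% d)%Z| : 'I_(`|d|.+1)) = inord `|(v %% d)%Z| ->
    (u = v %[mod d])%Z.
  move=> d_gt0.
  have lt w : (`|(w %% d)%Z| < `|d|.+1)%N.
    have := modz_ge0 w (lt0r_neq0 d_gt0); have := ltz_pmod w d_gt0; lia.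
  move=> /(congr1 (@nat_of_ord _)); rewrite !inordK // => /(congr1 Posz).
  by rewrite !gez0_abs ?modz_ge0 ?lt0r_neq0.
have key_inj : {in atoms M &, injective key}.
  move=> a b /set_mem ata /set_mem atb [] /(inord_mod _ _ _ kd_gt0) fab.
  move=> /(inord_mod _ _ _ ge) gab.
  have [Nf Ng] := congruent_atom_not_higher ata atb fab gab.
  have [Nf' Ng'] := congruent_atom_not_higher atb ata (esym fab) (esym gab).
  have fE : f a = f b by lia.
  by apply: fg_inj => //; lia.
by rewrite -(eq_finite_set (inj_card_eq key_inj)); apply: finite_finset.
Qed.

End FullColumn.

Lemma atomic_of_infinite_atoms : infinite_set (atoms M) -> atomic M.
Proof.
move=> inf; apply: atomic_of_columns_bounded => x Mx fx.
apply: contrapT => none; apply: inf.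
apply: (finite_atoms_of_full_column fx) => n.
by apply: contrapT => Nn; apply: none; exists n.
Qed.

End Supported.

(** * From rational support to an integral form *)

(** A line determines its normal vector up to a real factor [c], and a line of
    rational slope has an integral normal vector [(a, b)]; only the sign of [c]
    remains, which is absorbed by replacing [(a, b)] with its opposite. *)
Lemma integer_supporting_form (R : realType) M : rationally_supported R M ->
  exists a b, ((a != 0) || (b != 0)) /\ forall x, M x -> 0 <= linform a b x.
Proof.
move=> [L [[n1 n2] [n0 LE half]] slope].
have Ldot p : L p -> n1 * p.1 + n2 * p.2 = 0 by rewrite LE.
have [a [b [c [ab0 cE]]]] : exists (a b : int) (c : R),
    ((a != 0) || (b != 0)) /\
    forall x, dot (n1, n2) (plane_of R x) = c * (linform a b x)%:~R.
  case: slope => [[q qE]|vert].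
    (* [p.2 = q * p.1] amounts to [- numq q * p.1 + denq q * p.2 = 0]. *)
    exists (- numq q), (denq q), (n2 / (denq q)%:~R).
    rewrite denq_neq0 orbT; split=> // x.
    have n1E : n1 = - n2 * ratr q.
      have := Ldot (1, ratr q); rewrite qE /= !mulr1 => /(_ erefl).
      by move/eqP; rewrite addr_eq0 mulNr => /eqP.
    have dq0 : (denq q)%:~R != 0 :> R by rewrite intr_eq0 denq_neq0.
    rewrite /dot /= n1E /ratr /linform rmorphD !rmorphM rmorphN /=.
    by field.
  exists 1, 0, n1; split=> // x.
  have n2E : n2 = 0.
    by have := Ldot (0, 1); rewrite vert /= mulr0 mulr1 add0r; apply.
  by rewrite /dot /linform /= n2E !mul0r mul1r !addr0.
have c0 : c != 0.
  apply: contraNneq n0 => c0; apply/eqP.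
  have := cE (1, 0); have := cE (0, 1); rewrite c0 !mul0r /dot /=.
  by rewrite !(mulr0, mulr1) add0r addr0 => -> ->.
have flip x : linform (- a) (- b) x = - linform a b x.
  by rewrite /linform; ring.
have {}half : (forall x, M x -> 0 <= c * (linform a b x)%:~R) \/
    (forall x, M x -> c * (linform a b x)%:~R <= 0).
  by case: half => half; [left|right] => x Mx;
    rewrite -cE; apply: half; exists x.
have [c_lt0|c_gt0|/eqP] := ltgtP c 0; last by rewrite (negPf c0).
- case: half => half.
    exists (- a), (- b); rewrite !oppr_eq0; split=> // x /half.
    by rewrite flip nmulr_rge0 // lerz0 oppr_ge0.
  by exists a, b; split=> // x /half; rewrite nmulr_rle0 // ler0z.
- case: half => half.
    by exists a, b; split=> // x /half; rewrite pmulr_rge0 // ler0z.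
  exists (- a), (- b); rewrite !oppr_eq0; split=> // x /half.
  by rewrite flip pmulr_rle0 // lerz0 oppr_ge0.
Qed.

Theorem theorem3p4 (R : realType) (M : set (int * int))
    (hM : submonoid M) (hsupp : rationally_supported R M)
    (hinf : infinite_set (atoms M)) :
  atomic M.
Proof.
have [a [b [ab0 f_ge0]]] := integer_supporting_form hsupp.
have [units|] :=
  pselect (forall x, M x -> linform a b x = 0 -> invertibles M x).
  exact: (@atomic_of_level0_units M (linform a b)).
move=> /existsNP[e /not_implyP[Me /not_implyP[fe NUe]]].
have inj : forall x y, linform a b x = linform a b y ->
    linform (- b) a x = linform (- b) a y -> x = y.
  by move=> x y; apply: linform_inj_pair.
have neg x : linform b (- a) x = - linform (- b) a x.
  by rewrite /linform; ring.
have [ge|ge|ge] := ltgtP 0 (linform (- b) a e).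
- exact: (@atomic_of_infinite_atoms M (linform a b) (linform (- b) a) _ _ _ e).
- apply: (@atomic_of_infinite_atoms M
    (linform a b) (linform b (- a)) _ _ _ e) => //.
    by move=> x y E1; rewrite /= !neg => /oppr_inj; apply: inj.
  by rewrite /= neg oppr_gt0.
- case: NUe; suff -> : e = 0 by exact: invertible0.
  by apply: inj; rewrite raddf0.
Qed.
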